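(* Let $k \ge 1$, $n \ge 1$ and $1 \le r \le k$ be integers, and let $\lambda=(\lambda_1,\dots,\lambda_\ell)$ be an integer partition with $\ell$ parts. Then the number of small $(k,r)$-Fuss-Schr\''{o}der paths of length $n$ with type $\lambda$ is $$\binom{n-1}{|\lambda|-1}\binom{nk}{\ell-1}\frac{(\ell-1)!}{m_\lambda} = \frac{1}{nk+1}\binom{n-1}{|\lambda|-1}\binom{nk+1}{\ell}\frac{\ell!}{m_\lambda}.$$ In particular, when $k=1$ this number equals $\binom{n-1}{|\lambda|-1}\binom{n}{\ell-1}\frac{(\ell-1)!}{m_\lambda}=\frac{1}{n+1}\binom{n-1}{|\lambda|-1}\binom{n+1}{\ell}\frac{\ell!}{m_\lambda}$, and when $|\lambda|=n$ it equals $\binom{nk}{\ell-1}\frac{(\ell-1)!}{m_\lambda}=\frac{1}{nk+1}\binom{nk+1}{\ell}\frac{\ell!}{m_\lambda}$.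
   Context: Steps: east $E=(1,0)$, north $N=(0,1)$, diagonal $D=(1,1)$. For positive integers $k$ and $r$ with $1 \le r \le k$, a large $(k,r)$-Fuss-Schr\''{o}der path of length $n$ is a lattice path from $(0,0)$ to $(n,kn)$ using steps $E$, $N$, $D$ such that (C1) the path never passes below the line $y=kx$, and (C2) every diagonal step goes from the line $y=kj+r-1$ to the line $y=kj+r$ for some integer $j$. A small $(k,r)$-Fuss-Schr\''{o}der path is a large $(k,r)$-Fuss-Schr\''{o}der path with no diagonal step touching the line $y=kx$. The type of such a path is the integer partition formed by the lengths of its maximal runs of consecutive east steps. For a partition $\lambda$, $|\lambda|$ is the sum of its parts, $\ell=\ell(\lambda)$ its number of parts, and $m_\lambda = m_1(\lambda)!\,m_2(\lambda)!\,m_3(\lambda)!\cdots$, where $m_i(\lambda)$ is the number of parts of $\lambda$ equal to $i$. *)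

(* Defs.v *)
From HB Require Import structures.
From mathcomp Require Import all_boot all_order all_algebra.

Set Implicit Arguments.
Unset Strict Implicit.
Unset Printing Implicit Defensive.

Inductive step := East | North | Diag.

Definition step_code (s : step) : option bool :=
  match s with East => None | North => Some true | Diag => Some false end.

Definition step_decode (c : option bool) : step :=
  match c with None => East | Some true => North | Some false => Diag end.

Lemma step_codeK : cancel step_code step_decode.
Proof. by case. Qed.

HB.instance Definition _ := Finite.copy step (can_type step_codeK).

Definition move (v : nat * nat) (s : step) : nat * nat :=
  match s with
  | East => (v.1.+1, v.2)
  | North => (v.1, v.2.+1)
  | Diag => (v.1.+1, v.2.+1)
  end.

(* The vertex reached from the origin after the first i steps of p; step
   number i (from 0) of p goes from [vertex p i] to [vertex p i.+1]. *)
Definition vertex (p : seq step) (i : nat) : nat * nat :=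
  foldl move (0, 0) (take i p).

(* It suffices to look at the vertices, the path being affine in between. *)
Definition weakly_above (k : nat) (p : seq step) : bool :=
  all (fun i => k * (vertex p i).1 <= (vertex p i).2) (iota 0 (size p).+1).

(* For r >= 1: each diagonal step starts at a height of the form k j + r - 1
   with j an integer; it then ends at height k j + r (see diag_levelsP). *)
Definition diag_levels (k r : nat) (p : seq step) : bool :=
  all (fun i => (nth East p i == Diag) ==>
                ((vertex p i).2 == r.-1 %[mod k])) (iota 0 (size p)).

Definition large_path (k r n : nat) (p : seq step) : bool :=
  [&& vertex p (size p) == (n, k * n), weakly_above k p & diag_levels k r p].

Definition on_line (k : nat) (v : nat * nat) : bool := v.2 == k * v.1.

(* A segment lying weakly above a line touches it iff one of its two
   endpoints is on the line. *)
Definition no_diag_touching (k : nat) (p : seq step) : bool :=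
  all (fun i => (nth East p i == Diag) ==>
                ~~ (on_line k (vertex p i) || on_line k (vertex p i.+1)))
      (iota 0 (size p)).

Definition small_path (k r n : nat) (p : seq step) : bool :=
  large_path k r n p && no_diag_touching k p.

(* Lengths of the maximal runs of East steps of p, from left to right, when p
   is preceded by c further East steps. *)
Fixpoint east_runs_from (c : nat) (p : seq step) : seq nat :=
  match p with
  | [::] => if c is 0 then [::] else [:: c]
  | East :: q => east_runs_from c.+1 q
  | _ :: q => if c is 0 then east_runs_from 0 q else c :: east_runs_from 0 q
  end.

Definition east_runs (p : seq step) : seq nat := east_runs_from 0 p.

(* Integer partitions are the nonincreasing sequences of positive integers. *)
Definition is_partition (lam : seq nat) : bool :=
  sorted geq lam && all (fun a => 0 < a) lam.

Definition path_type (p : seq step) : seq nat := sort geq (east_runs p).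

(* The bound on the number of steps makes the ambient type finite; it excludes
   no path (see size_large_path). *)
Definition small_paths_of_type (k r n : nat) (lam : seq nat) :
    {set (n + k * n).-bseq step} :=
  [set p : (n + k * n).-bseq step |
     small_path k r n p && (path_type p == lam)].

(* m_lam; all the parts of lam are at most sumn lam, and larger i would only
   contribute factors 0! = 1. *)
Definition mult_fact (lam : seq nat) : nat :=
  \prod_(1 <= i < (sumn lam).+1) (count_mem i lam)`!.

(* Binomial coefficient with an integer lower index, zero when it is negative:
   the lower index |lam| - 1 is -1 for the empty partition. *)
Definition binz (a : nat) (b : int) : nat :=
  match b with Posz j => 'C(a, j) | Negz _ => 0 end.

Lemma diag_levelsP (k r : nat) (p : seq step) : 0 < r ->
  reflect (forall i, i < size p -> nth East p i = Diag ->
             exists j : int,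
               ((vertex p i).2%:Z = k%:Z * j + r%:Z - 1 /\
                (vertex p i.+1).2%:Z = k%:Z * j + r%:Z)%R)
          (diag_levels k r p).
Proof.
move=> r_gt0; have rE : (r%:Z - 1 = r.-1%:Z)%R.
  by case: r r_gt0 => // r _; rewrite /= intS GRing.addrC GRing.addKr.
have nextE i : i < size p -> nth East p i = Diag ->
    ((vertex p i.+1).2%:Z = (vertex p i).2%:Z + 1)%R.
  move=> lt_ip pi; rewrite /vertex (take_nth East lt_ip) pi foldl_rcons /=.
  by rewrite intS GRing.addrC.
have modE i : ((vertex p i).2 == r.-1 %[mod k]) <->
    exists j : int, ((vertex p i).2%:Z = k%:Z * j + r%:Z - 1)%R.
  rewrite -eqz_nat -!modz_nat eqz_mod_dvd -rE; split.
    case/dvdzP => j jE; exists j.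
    by rewrite GRing.mulrC -GRing.addrA -jE GRing.subrK.
  case=> j ->; apply/dvdzP; exists j.
  by rewrite -(GRing.addrA _ r%:Z)%R GRing.addrK GRing.mulrC.
apply: (iffP allP) => [H i lt_ip pi | H i].
  have := H i; rewrite mem_iota add0n lt_ip pi eqxx => /(_ isT) /modE [j jE].
  exists j; split=> //; rewrite nextE // jE.
  by rewrite GRing.subrK.
rewrite mem_iota add0n => /= lt_ip; apply/implyP => /eqP pi.
by apply/modE; have [j [jE _]] := H i lt_ip pi; exists j.
Qed.

Lemma size_large_path (k r n : nat) (p : seq step) :
  large_path k r n p -> size p <= n + k * n.
Proof.
case/and3P => /eqP + _ _; rewrite /vertex take_size.
suff H v : v.1 + v.2 + size p <= (foldl move v p).1 + (foldl move v p).2.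
  by move=> pE; have := H (0, 0); rewrite pE.
elim: p v => [|s p IHp] v /=; first by rewrite addn0.
have := IHp (move v s); apply: leq_trans.
by rewrite addnS -addSn leq_add2r; case: s => //=; rewrite ?addnS ?addSn.
Qed.

(* Main.v *)
(* A path is determined by the numbers of east steps at the heights 0, ..., nk
   and by the set of those j < n for which it has a diagonal step starting at
   height kj + r - 1. Let b_j be the number of east and diagonal steps starting
   at the heights kj, ..., kj + k - 1. Whatever r is, the path is small iff
   b_0 + ... + b_j <= j for all j < n: inside a block the last such inequality is
   the strongest, and a diagonal step starting at abscissa x must have x < j.
   If t is the number of east steps at the final height nk, then b_0, ...,
   b_(n-1) add up to n - t, so by the cycle lemma exactly t of the n rotations of
   the blocks give a small path. Hence n times the number of small paths of type
   lam is the sum of t over all the C(n, |lam|) (nk+1)! / (m_lam (nk+1-l)!)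
   arrangements, and by symmetry between the nk+1 heights t is |lam| / (nk+1) on
   average. *)

Require Import Defs.
From mathcomp Require Import all_boot all_order all_algebra.
From mathcomp Require Import zify ring.

Set Implicit Arguments.
Unset Strict Implicit.
Unset Printing Implicit Defensive.

Import GRing.Theory Num.Theory.

(* Minimum over the prefixes c of b, the empty one included, of size c - sumn c. *)
Fixpoint min_prefix (b : seq nat) : int :=
  match b with
  | [::] => 0%Z
  | x :: c => Num.min 0%R (1 - x%:Z + min_prefix c)%R
  end.

Definition subdiagonal (b : seq nat) : bool :=
  match b with
  | [::] => true
  | x :: c => (x%:Z <= min_prefix c)%R
  end.

Lemma min_prefix_le0 (b : seq nat) : (min_prefix b <= 0)%R.
Proof. by case: b => //= x c; lia. Qed.

Lemma min_prefix_rcons (c : seq nat) (x : nat) : sumn c + x <= (size c).+1 ->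
  min_prefix (rcons c x) = min_prefix c.
Proof.
suff H (a : int) : (0 <= a + (size c).+1%:Z - (sumn c)%:Z - x%:Z)%R ->
    Num.min 0%R (a + min_prefix (rcons c x))%R = Num.min 0%R (a + min_prefix c)%R.
  move=> h; have := H 0%R; rewrite !add0r.
  have := min_prefix_le0 (rcons c x); have := min_prefix_le0 c; lia.
elim: c a => [|y c IHc] a /=; first by lia.
by move=> h; have := IHc (a + 1 - y%:Z)%R; lia.
Qed.

Lemma subdiagonal_rot1 (x : nat) (c : seq nat) : sumn (x :: c) <= size (x :: c) ->
  (min_prefix (rcons c x) + 1 - x%:Z - min_prefix (x :: c))%R
  = Posz (subdiagonal (x :: c)).
Proof.
move=> h; rewrite min_prefix_rcons; last by move: h => /=; lia.
by rewrite /=; have := min_prefix_le0 c; lia.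
Qed.

(* The summands telescope along the rotations. *)
Lemma cycle_lemma (b : seq nat) : sumn b <= size b ->
  \sum_(i < size b) subdiagonal (rot i b) = size b - sumn b.
Proof.
move=> hb.
suff H m : m <= size b ->
    ((\sum_(i < m) subdiagonal (rot i b))%N%:Z
     = min_prefix (rot m b) - min_prefix b + m%:Z - (sumn (take m b))%:Z)%R.
  by have := H _ (leqnn _); rewrite rot_size take_size; lia.
elim: m => [|m IHm] hm; first by rewrite big_ord0 rot0 take0 /=; lia.
rewrite big_ord_recr /= PoszD IHm ?(ltnW hm) // (take_nth 0) // sumn_rcons.
have E : rot m b = nth 0 b m :: (drop m.+1 b ++ take m b).
  by rewrite /rot (drop_nth 0).
have sE : sumn (rot m b) = sumn b by rewrite /rot sumn_cat addnC -sumn_cat cat_take_drop.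
have zE := size_rot m b.
rewrite rotS // E rot1_cons -subdiagonal_rot1; last by rewrite -E sE zE.
by lia.
Qed.

Lemma size_permutations_prod (T : eqType) (s r : seq T) :
  uniq r -> {subset s <= r} ->
  size (permutations s) * \prod_(x <- r) (count_mem x s)`! = (size s)`!.
Proof.
move=> Ur; move sz: (size s) => m.
elim: m s sz => [|m IHm] s sz sub.
  by rewrite (size0nil sz) /= big1 ?muln1.
rewrite (perm_size (permutationsE _)) ?sz // size_allpairs_dep sumnE big_map.
rewrite big_distrl /= factS -sz.
transitivity (\sum_(x <- undup s) count_mem x s * m`!).
  rewrite big_seq [RHS]big_seq; apply: eq_bigr => x; rewrite mem_undup => xs.
  have szx : size (rem x s) = m by rewrite size_rem // sz.
  have subx : {subset rem x s <= r} by move=> y /mem_rem; apply: sub.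
  rewrite -(IHm _ szx subx) mulnCA; congr (_ * _).
  rewrite !(bigD1_seq x (sub _ xs) Ur) /= mulnA; congr (_ * _).
    rewrite count_rem xs /= eqxx.
    have : 0 < count_mem x s by rewrite -has_count has_pred1.
    by case: (count_mem x s) => // c _; rewrite factS subn1.
  apply: eq_bigr => y /negPf yx.
  by rewrite count_rem /= [x == y]eq_sym yx andbF subn0.
rewrite -big_distrl /=; congr (_ * _).
rewrite -sum1_size -(big_undup_iterop_count addn s xpredT); apply: eq_bigr => x _.
by rewrite Monoid.iteropE iter_addn addn0 mul1n.
Qed.

Lemma sum_reindex_uniq (T : eqType) (L : seq T) (f : T -> T) (F : T -> nat) :
  uniq L -> {in L &, injective f} -> {in L, forall x, f x \in L} ->
  \sum_(x <- L) F (f x) = \sum_(x <- L) F x.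
Proof.
move=> UL inj cl; rewrite -[LHS](big_map f xpredT); apply: perm_big.
have Uf : uniq (map f L) by rewrite map_inj_in_uniq.
have sub : {subset map f L <= L} by move=> _ /mapP [x xL ->]; apply: cl.
have [] := uniq_min_size Uf sub; first by rewrite size_map.
by move=> _ E; apply: uniq_perm.
Qed.

Lemma sum_head_permutations (s : seq nat) :
  size s * \sum_(t <- permutations s) head 0 t = sumn s * size (permutations s).
Proof.
have E i : i < size s ->
    \sum_(t <- permutations s) head 0 t = \sum_(t <- permutations s) nth 0 t i.
  move=> hi; rewrite -(@sum_reindex_uniq _ _ (rot i)) ?permutations_uniq //.
  - rewrite big_seq [RHS]big_seq; apply: eq_bigr => t.
    rewrite mem_permutations => /perm_size st.
    by rewrite -nth0 /rot nth_cat size_drop st subn_gt0 hi nth_drop addn0.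
  - by move=> x y _ _; apply: rot_inj.
  by move=> t; rewrite !mem_permutations perm_rot.
rewrite -[X in X * _]card_ord -sum_nat_const.
rewrite (eq_bigr (fun i : 'I_(size s) => \sum_(t <- permutations s) nth 0 t i));
  last by move=> i _; apply: E.
rewrite exchange_big /= -[size (permutations s)]sum1_size big_distrr /=.
rewrite big_seq [RHS]big_seq; apply: eq_bigr => t.
rewrite mem_permutations muln1 => pt; rewrite -(perm_size pt) -(perm_sumn pt).
by rewrite sumnE (big_nth 0) big_mkord.
Qed.

(* [path_of w t] has at height i the i-th pair of w: the number of east steps
   at that height, and whether the step leaving it is diagonal. *)
Fixpoint path_of (w : seq (nat * bool)) (t : nat) : seq step :=
  match w with
  | [::] => nseq t East
  | (e, d) :: w' =>
      nseq e East ++ (if d then Diag else North) :: path_of w' t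
  end.

Fixpoint rows (p : seq step) : seq (nat * bool) * nat :=
  match p with
  | [::] => ([::], 0)
  | East :: q => match rows q with
                 | ([::], t) => ([::], t.+1)
                 | ((e, d) :: w, t) => ((e.+1, d) :: w, t)
                 end
  | North :: q => ((0, false) :: (rows q).1, (rows q).2)
  | Diag :: q => ((0, true) :: (rows q).1, (rows q).2)
  end.

Lemma rowsK (p : seq step) : path_of (rows p).1 (rows p).2 = p.
Proof.
elim: p => [|[] q /= IHq] //=; rewrite ?IHq //.
by case: (rows q) IHq => [[|[e d] w] t] /= ->.
Qed.

Lemma path_ofK (w : seq (nat * bool)) (t : nat) : rows (path_of w t) = (w, t).
Proof.
elim: w => [|[e d] w IHw] /=; first by elim: t => //= t ->.
have E : rows ((if d then Diag else North) :: path_of w t) = ((0, d) :: w, t).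
  by case: d; rewrite /= IHw.
suff -> : rows (nseq e East ++ (if d then Diag else North) :: path_of w t)
    = ((0 + e, d) :: w, t) by [].
by elim: e => [|e /= ->] //; rewrite addnS.
Qed.

Fixpoint walk (k r : nat) (v : nat * nat) (p : seq step) : bool :=
  (k * v.1 <= v.2) &&
  (if p is s :: q then
     ((s == Diag) ==> (v.2 == r.-1 %[mod k])
                      && ~~ (on_line k v || on_line k (move v s)))
     && walk k r (move v s) q
   else true).

Lemma walkE (k r : nat) (p : seq step) :
  walk k r (0, 0) p
  = [&& weakly_above k p, diag_levels k r p & no_diag_touching k p].
Proof.
rewrite /weakly_above /diag_levels /no_diag_touching /vertex.
elim: p (0, 0) => [|s p IHp] v; first by rewrite /= !andbT.
have iotaE m (P : pred nat) :
    all P (iota 0 m.+1) = P 0 && all (fun i => P i.+1) (iota 0 m).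
  by rewrite /= (iotaDl 1 0) all_map.
rewrite !(iotaE (size p)) (iotaE (size (s :: p))) [LHS]/= IHp.
rewrite /= !take0; case: (k * v.1 <= v.2) => //=; case: (s == Diag) => //=.
have AC (a b c d e : bool) : [&& a && b, c, d & e] = [&& c, a && d & b && e].
  by case: a; case: b; case: c; case: d.
exact: AC.
Qed.

Lemma walk_nseq (k r x y e : nat) (q : seq step) :
  walk k r (x, y) (nseq e East ++ q) = walk k r (x + e, y) q.
Proof.
elim: e x => [|e IHe] x; first by rewrite addn0.
rewrite /= IHe addSnnS; case W : walk; last by rewrite andbF.
have : k * (x + e.+1) <= y by case: q W {IHe} => [|s q] /= /andP[].
by rewrite mulnDr => /(leq_trans (leq_addr _ _)) ->.
Qed.

Lemma walk_path_of_cons (k r x y e : nat) (d : bool) (w : seq (nat * bool)) (t : nat) :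
  walk k r (x, y) (path_of ((e, d) :: w) t) =
  [&& k * (x + e) <= y,
      d ==> [&& y == r.-1 %[mod k], k * (x + e) != y & k * (x + e).+1 != y.+1]
    & walk k r (x + e + d, y.+1) (path_of w t)].
Proof.
rewrite /= walk_nseq; case: d => /=; last by rewrite addn0.
by rewrite addn1 /on_line /= negb_or ![_ == k * _]eq_sym.
Qed.

Lemma foldl_move_path_of (v : nat * nat) (w : seq (nat * bool)) (t : nat) :
  foldl move v (path_of w t)
  = (v.1 + sumn (unzip1 w) + count id (unzip2 w) + t, v.2 + size w).
Proof.
have nseqE u e : foldl move u (nseq e East) = (u.1 + e, u.2).
  by elim: e u => [|e IHe] [x y] /=; rewrite ?addn0 // IHe addSnnS.
elim: w v => [|[e d] w IHw] v /=; first by rewrite nseqE !addn0.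
by rewrite foldl_cat /= nseqE IHw; case: d => /=; congr (_, _); lia.
Qed.

Lemma east_runs_path_of (w : seq (nat * bool)) (t : nat) :
  east_runs (path_of w t) = [seq e <- rcons (unzip1 w) t | 0 < e].
Proof.
have nseqE c e q : east_runs_from c (nseq e East ++ q) = east_runs_from (c + e) q.
  by elim: e c => [|e IHe] c /=; rewrite ?addn0 // IHe addSnnS.
rewrite /east_runs; elim: w => [|[e d] w IHw] /=.
  by rewrite -[nseq t East]cats0 nseqE; case: t.
by rewrite nseqE; case: d; case: e => //= e; rewrite IHw.
Qed.

Definition row_block (k r : nat) (es : seq nat) (d : bool) : seq (nat * bool) :=
  zip es (mkseq (fun i => (i == r.-1) && d) k).

Lemma walk_row_block (k r x j t : nat) (es : seq nat) (d : bool) (w : seq (nat * bool)) :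
  1 <= r <= k -> size es = k ->
  walk k r (x, k * j) (path_of (row_block k r es d ++ w) t)
  = (x + (sumn es + d) <= j)
    && walk k r (x + (sumn es + d), k * j.+1) (path_of w t).
Proof.
move=> hr hes.
(* At row c of the block, the diagonal step of the block is still to come iff c < r. *)
suff H (fs : seq nat) c x' : c + size fs = k -> 0 < size fs ->
    walk k r (x', k * j + c)
      (path_of (zip fs (map (fun i => (i == r.-1) && d) (iota c (size fs))) ++ w) t)
    = (x' + sumn fs + (d && (c < r)) <= j)
      && walk k r (x' + sumn fs + (d && (c < r)), k * j.+1) (path_of w t).
  have := H es 0 x; rewrite /row_block /mkseq hes !addn0 => -> //; last by lia.
  by case/andP: hr => -> _; rewrite andbT !addnA.
elim: fs c x' => // e fs IHfs c x' szc _; rewrite [zip _ _]/= cat_cons walk_path_of_cons.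
have ltck : c < k by move: szc => /=; lia.
have levelE : (k * j + c == r.-1 %[mod k]) = (c == r.-1).
  by rewrite mulnC modnMDl !modn_small //; lia.
rewrite levelE.
have leE z : (k * z <= k * j + c) = (z <= j).
  apply/idP/idP => h; last by rewrite (leq_trans _ (leq_addr _ _)) ?leq_mul2l ?h ?orbT.
  rewrite leqNgt; apply/negP => jz.
  have : k * j.+1 <= k * z by rewrite leq_mul2l jz orbT.
  by rewrite mulnS; lia.
have ltE z : z < j -> (k * z != k * j + c) && (k * z.+1 != (k * j + c).+1).
  by move=> h; have : k * z.+1 <= k * j; [rewrite leq_mul2l h orbT|rewrite mulnS; lia].
rewrite leE; case: (posnP (size fs)) => [/size0nil fs0|fs_gt0].
  rewrite fs0 /= addn0.
  have cE : (k * j + c).+1 = k * j.+1 by move: szc; rewrite fs0 mulnS /=; lia.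
  rewrite cE.
  case: d {IHfs} => /=; last by rewrite andbF !addn0.
  rewrite andbT; case: (eqVneq c r.-1) => [cr|cr] /=; last first.
    by rewrite (_ : (c < r) = false) ?addn0 //; lia.
  rewrite (_ : c < r); last by lia.
  rewrite /= eqn_mul2l (_ : (k == 0) = false) /=; last by lia.
  rewrite addn1 eqSS; case: (ltngtP (x' + e) j) => //= xj; last by rewrite andbF.
  by case/andP: (ltE _ xj) => ->.
rewrite -(addnS (k * j)) IHfs //; last by move: szc => /=; lia.
case: d {IHfs} => /=; last first.
  by rewrite andbF /= !addn0 addnA; case: leqP => // ?; case: leqP => //; lia.
rewrite andbT; case: (eqVneq c r.-1) => [cr|cr] /=.
  have [-> ->] : (c.+1 < r) = false /\ (c < r) = true by lia.
  have -> : x' + (e + sumn fs) + true = x' + e + true + sumn fs + false by rewrite /=; lia.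
  case: (leqP (x' + e + true + sumn fs + false) j) => /= h; last by rewrite !andbF.
  have xj : x' + e < j by lia.
  by have := ltE _ xj; rewrite (ltnW xj) -(addnS (k * j)) => ->.
have -> : (c.+1 < r) = (c < r) by lia.
rewrite addn0 !addnA; case: (leqP (x' + e + sumn fs + (c < r)) j) => /= h; last by rewrite !andbF.
by rewrite (_ : x' + e <= j) //; lia.
Qed.

Fixpoint rows_of (k r : nat) (es : seq nat) (ds : seq bool) : seq (nat * bool) :=
  if ds is d :: ds' then
    row_block k r (take k es) d ++ rows_of k r (drop k es) ds'
  else [::].

Fixpoint block_sums (k : nat) (es : seq nat) (ds : seq bool) : seq nat :=
  if ds is d :: ds' then
    (sumn (take k es) + d) :: block_sums k (drop k es) ds'
  else [::].

Lemma size_block_sums (k : nat) (es : seq nat) (ds : seq bool) :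
  size (block_sums k es ds) = size ds.
Proof. by elim: ds es => //= d ds IHds es; rewrite IHds. Qed.

Lemma sumn_block_sums (k : nat) (es : seq nat) (ds : seq bool) :
  size es = size ds * k -> sumn (block_sums k es ds) = sumn es + count id ds.
Proof.
elim: ds es => [|d ds IHds] es /= sz; first by rewrite (size0nil sz).
rewrite IHds; last by rewrite size_drop sz mulSn addKn.
by rewrite -[in RHS](cat_take_drop k es) sumn_cat; lia.
Qed.

Lemma block_sums_cat (k : nat) (es b : seq nat) (ds : seq bool) (d : bool) :
  size es = size ds * k -> size b = k ->
  block_sums k (es ++ b) (rcons ds d) = rcons (block_sums k es ds) (sumn b + d).
Proof.
move=> + szb; elim: ds es => [|d' ds IHds] es /= sz.
  by rewrite (size0nil sz) /= -szb take_size.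
have kes : k <= size es by rewrite sz mulSn leq_addr.
rewrite takel_cat // drop_cat.
case: (ltnP k (size es)) => h; first by rewrite IHds // size_drop sz mulSn addKn.
have es_k : size es = k by lia.
have ds0 : size ds * k = 0 by lia.
by rewrite es_k subnn drop0 -[b]/([::] ++ b) IHds -?es_k ?drop_size //= es_k ds0.
Qed.

Lemma block_sums_rot (k : nat) (es : seq nat) (ds : seq bool) :
  size es = size ds * k -> 0 < size ds ->
  block_sums k (rot k es) (rot 1 ds) = rot 1 (block_sums k es ds).
Proof.
case: ds => //= d ds sz _; rewrite !rot1_cons block_sums_cat //.
  by rewrite size_drop sz mulSn addKn.
by rewrite size_takel // sz mulSn leq_addr.
Qed.

Lemma unzip1_rows_of (k r : nat) (es : seq nat) (ds : seq bool) :
  size es = size ds * k -> unzip1 (rows_of k r es ds) = es.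
Proof.
elim: ds es => [|d ds IHds] es /= sz; first by rewrite (size0nil sz).
rewrite /unzip1 map_cat -/unzip1 IHds; last by rewrite size_drop sz mulSn addKn.
rewrite unzip1_zip ?cat_take_drop //.
by rewrite size_mkseq size_take_min geq_minl.
Qed.

Lemma unzip2_rows_of (k r : nat) (es : seq nat) (ds : seq bool) :
  size es = size ds * k ->
  unzip2 (rows_of k r es ds)
  = flatten [seq mkseq (fun i => (i == r.-1) && d) k | d <- ds].
Proof.
elim: ds es => [|d ds IHds] es //= sz.
rewrite /unzip2 map_cat -/unzip2 IHds; last by rewrite size_drop sz mulSn addKn.
rewrite unzip2_zip // size_mkseq size_takel //.
by rewrite sz mulSn leq_addr.
Qed.

Lemma count_row_block (k r : nat) (d : bool) : 0 < r <= k ->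
  count id (mkseq (fun i => (i == r.-1) && d) k) = d.
Proof.
move=> hr; rewrite count_map; case: d; last first.
  by rewrite (eq_count (a2 := pred0)) ?count_pred0 // => i; rewrite /= andbF.
rewrite (eq_count (a2 := pred1 r.-1)) => [|i]; last by rewrite /= andbT.
by rewrite count_uniq_mem ?iota_uniq // mem_iota; congr nat_of_bool; lia.
Qed.

Lemma count_rows_of (k r : nat) (es : seq nat) (ds : seq bool) :
  0 < r <= k -> size es = size ds * k ->
  count id (unzip2 (rows_of k r es ds)) = count id ds.
Proof.
move=> hr sz; rewrite unzip2_rows_of // count_flatten -map_comp.
by elim: ds {sz} => //= d ds ->; rewrite count_row_block.
Qed.

Lemma rows_of_inj (k r : nat) (es es' : seq nat) (ds ds' : seq bool) :
  0 < r <= k -> size es = size ds * k -> size es' = size ds' * k ->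
  rows_of k r es ds = rows_of k r es' ds' -> es = es' /\ ds = ds'.
Proof.
move=> hr sz sz' E; have esE : es = es'.
  by rewrite -(unzip1_rows_of r sz) E unzip1_rows_of.
split=> //; have : size ds = size ds'.
  by apply/eqP; rewrite -(eqn_pmul2r (_ : 0 < k)) -?sz -?sz' ?esE //; lia.
have := congr1 unzip2 E; rewrite !unzip2_rows_of //.
elim: ds ds' {sz sz' E esE} => [|d ds IHds] [|d' ds'] //= /eqP.
rewrite eqseq_cat ?size_mkseq // => /andP[/eqP E /eqP Es] [szE].
rewrite (IHds ds') //; congr (_ :: _).
by have := congr1 (nth false ^~ r.-1) E; rewrite !nth_mkseq ?eqxx //; lia.
Qed.

Lemma rows_of_exists (k r n : nat) (w : seq (nat * bool)) :
  0 < r <= k -> size w = n * k ->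
  (forall i, i < size w -> (nth (0, false) w i).2 -> i = r.-1 %[mod k]) ->
  exists2 ds, size ds = n & w = rows_of k r (unzip1 w) ds.
Proof.
move=> hr; elim: n w => [|n IHn] w sz lev; first by exists [::]; rewrite // (size0nil sz).
have szd : size (drop k w) = n * k by rewrite size_drop sz mulSn addKn.
have kw : k <= size w by rewrite sz mulSn leq_addr.
have [i lt_i wi|ds szds wE] := IHn _ szd.
  rewrite -[RHS](lev (k + i)) -?nth_drop // ?modnDl //.
  by move: lt_i; rewrite size_drop; lia.
exists (nth false (unzip2 (take k w)) r.-1 :: ds); rewrite /= ?szds //.
rewrite /unzip1 -map_drop -wE -[LHS](cat_take_drop k w); congr (_ ++ _).
rewrite -[LHS]zip_unzip /row_block -map_take; congr zip.
have szt : size (take k w) = k by rewrite size_takel.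
apply: (@eq_from_nth _ false) => [|i]; rewrite size_map szt ?size_mkseq // => lt_ik.
rewrite nth_mkseq //; case: (eqVneq i r.-1) => [->|ir] //=.
apply/negP; rewrite (nth_map (0, false)) ?szt // nth_take // => /(lev _ (leq_trans lt_ik kw)).
by rewrite !modn_small; lia.
Qed.

Lemma walk_diag_level (k r x y t i : nat) (w : seq (nat * bool)) :
  walk k r (x, y) (path_of w t) -> i < size w -> (nth (0, false) w i).2 ->
  y + i = r.-1 %[mod k].
Proof.
elim: w x y i => [|[e d] w IHw] x y [|i] //.
  rewrite walk_path_of_cons => /and3P[_ + _] _ /= hd; rewrite hd addn0.
  by case/and3P => /eqP.
by rewrite walk_path_of_cons => /and3P[_ _ /IHw H] /H; rewrite addnS.
Qed.

Lemma walk_rows_of (k r t : nat) (es : seq nat) (ds : seq bool) :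
  0 < r <= k -> 0 < size ds -> size es = size ds * k ->
  sumn es + count id ds + t = size ds ->
  walk k r (0, 0) (path_of (rows_of k r es ds) t) = subdiagonal (block_sums k es ds).
Proof.
move=> hr; have H x j (fs : seq nat) (bs : seq bool) :
    x < j -> size fs = size bs * k -> x + sumn (block_sums k fs bs) + t = j + size bs ->
    walk k r (x, k * j) (path_of (rows_of k r fs bs) t)
    = (x%:Z + 1 <= j%:Z + min_prefix (block_sums k fs bs))%R.
  elim: bs fs x j => [|b bs IHbs] fs x j xj sz; rewrite [block_sums _ _ _]/=.
    rewrite /= !addn0 -[nseq t East]cats0 walk_nseq /= andbT => ->.
    by rewrite leqnn /=; lia.
  have szd : size (drop k fs) = size bs * k by rewrite size_drop sz mulSn addKn.
  rewrite [rows_of _ _ _ _]/= walk_row_block //; last first.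
    by rewrite size_takel // sz mulSn leq_addr.
  move=> /= tot; have := min_prefix_le0 (block_sums k (drop k fs) bs).
  case: (leqP (x + (sumn (take k fs) + b)) j) => h /= mp; last by lia.
  by rewrite IHbs //; lia.
case: ds => // d ds _ sz; rewrite -(sumn_block_sums sz) /= => tot.
have szd : size (drop k es) = size ds * k by rewrite size_drop sz mulSn addKn.
have -> : (0, 0) = (0, k * 0) by rewrite muln0.
rewrite walk_row_block //; last first.
  by rewrite size_takel // sz mulSn leq_addr.
have := min_prefix_le0 (block_sums k (drop k es) ds).
case: (leqP (0 + (sumn (take k es) + d)) 0) => h /= mp; last by lia.
by rewrite H //; lia.
Qed.

Lemma leq_size_sumn (s : seq nat) : all (ltn 0) s -> size s <= sumn s.
Proof. by elim: s => //= x s IHs /andP[x0 /IHs]; lia. Qed.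

Lemma path_type_eq (p : seq step) (es lam : seq nat) :
  is_partition lam -> size lam <= size es ->
  perm_eq (east_runs p) [seq e <- es | 0 < e] ->
  (path_type p == lam) = perm_eq es (lam ++ nseq (size es - size lam) 0).
Proof.
case/andP=> lam_sorted lam_pos szl runs.
have lamE : [seq e <- lam ++ nseq (size es - size lam) 0 | 0 < e] = lam.
  by rewrite filter_cat (all_filterP lam_pos) filter_nseq cats0.
apply/eqP/idP => [typ|pes].
  have pl : perm_eq [seq e <- es | 0 < e] lam.
    by rewrite -typ /path_type perm_sym perm_sort.
  rewrite -(perm_filterC (ltn 0) es) (perm_catl _ (_ : perm_eq _ (nseq (size es - size lam) 0))).
    by rewrite perm_cat2r.
  rewrite (_ : [seq _ <- es | _] = nseq (size es - size lam) 0) //.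
  have -> : size es - size lam = size [seq e <- es | predC (ltn 0) e].
    by rewrite -(perm_size pl) !size_filter -(count_predC (ltn 0) es) addKn.
  apply/all_pred1P/allP => e; rewrite mem_filter /= => /andP[].
  by case: e.
apply: (@sorted_eq _ geq) => //.
- by move=> a b c /= h1 h2; apply: leq_trans h2 h1.
- by move=> a b /=; lia.
- by apply: sort_sorted => a b; rewrite /= leq_total.
rewrite perm_sort (permPl runs) -[X in perm_eq _ X]lamE; exact: perm_filter.
Qed.

Lemma perm_eq_bool (s t : seq bool) :
  size s = size t -> count id s = count id t -> perm_eq s t.
Proof.
move=> sz c; apply/allP => b _ /=; apply/eqP.
have E (u : seq bool) : count_mem true u = count id u by apply: eq_count; case.
have F (u : seq bool) : count_mem false u = size u - count id u.
  by rewrite -(count_predC id u) addKn; apply: eq_count; case.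
by case: b; rewrite ?E ?F ?sz c.
Qed.

(* An arrangement (t :: es, ds) encodes the path with t east steps at the final
   height, es at the lower heights, and ds marking the blocks with a diagonal. *)
Definition arrangements (N : nat) (lam : seq nat) (n : nat) : seq (seq nat * seq bool) :=
  [seq (es, ds) | es <- permutations (lam ++ nseq (N - size lam) 0),
                  ds <- permutations (nseq (sumn lam) false ++ nseq (n - sumn lam) true)].

Definition arrangement_path (k r : nat) (X : seq nat * seq bool) : seq step :=
  path_of (rows_of k r (behead X.1) X.2) (head 0 X.1).

Definition small_arrangement (k : nat) (X : seq nat * seq bool) : bool :=
  subdiagonal (block_sums k (behead X.1) X.2).

Lemma arrangementsP (N n : nat) (lam : seq nat) (X : seq nat * seq bool) :
  size lam <= N -> sumn lam <= n ->
  reflect [/\ size X.1 = N, size X.2 = n, sumn X.1 + count id X.2 = n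
             & perm_eq X.1 (lam ++ nseq (N - size lam) 0)]
          (X \in arrangements N lam n).
Proof.
move=> szl sl; have mE : (X \in arrangements N lam n) =
    perm_eq X.1 (lam ++ nseq (N - size lam) 0)
    && perm_eq X.2 (nseq (sumn lam) false ++ nseq (n - sumn lam) true).
  rewrite -!mem_permutations; case: X => es ds /=.
  by apply/allpairsP/andP => [[[a b] /= [? ? [-> ->]]] //|[? ?]]; exists (es, ds).
have sE : perm_eq X.1 (lam ++ nseq (N - size lam) 0) ->
    size X.1 = N /\ sumn X.1 = sumn lam.
  move=> p; rewrite (perm_size p) (perm_sumn p) size_cat size_nseq subnKC //.
  by rewrite sumn_cat sumn_nseq mul0n addn0.
rewrite mE; apply: (iffP andP) => [[p1 p2]|[sz1 sz2 tot p1]]; have [s1 s2] := sE p1.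
  split=> //; first by rewrite (perm_size p2) size_cat !size_nseq subnKC.
  rewrite s2 (permP p2) count_cat !count_nseq /=; lia.
split=> //; apply: perm_eq_bool.
  by rewrite sz2 size_cat !size_nseq subnKC.
by rewrite count_cat !count_nseq /=; lia.
Qed.

Lemma small_path_arrangement (k r n : nat) (lam : seq nat) (X : seq nat * seq bool) :
  0 < r <= k -> 0 < n -> is_partition lam -> size lam <= (n * k).+1 ->
  size X.1 = (n * k).+1 -> size X.2 = n ->
  small_path k r n (arrangement_path k r X) && (path_type (arrangement_path k r X) == lam)
  = [&& sumn X.1 + count id X.2 == n,
        perm_eq X.1 (lam ++ nseq ((n * k).+1 - size lam) 0)
      & small_arrangement k X].
Proof.
case: X => [[|t es] ds] //= hr n0 hlam szl [sz] szd.
have sz' : size es = size ds * k by rewrite sz szd.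
have szl' : size lam <= size (t :: es) by rewrite /= sz.
rewrite (path_type_eq hlam szl') ?[size (t :: es)]/= ?sz; last first.
  rewrite east_runs_path_of unzip1_rows_of //; apply: perm_filter.
  by rewrite perm_rcons.
rewrite [LHS]andbC [RHS]andbCA; case: (perm_eq _ _) => //=.
have -> p : small_path k r n p = (vertex p (size p) == (n, k * n)) && walk k r (0, 0) p.
  by rewrite walkE /small_path /large_path; case: (_ == _); case: (weakly_above _ _).
rewrite /vertex take_size foldl_move_path_of unzip1_rows_of // count_rows_of //=.
rewrite -(size_map fst) -/(unzip1 _) unzip1_rows_of // sz [k * n]mulnC.
rewrite xpair_eqE eqxx andbT !add0n.
rewrite (_ : t + sumn es + count id ds = sumn es + count id ds + t); last by lia.
case: eqP => //= tot; rewrite walk_rows_of ?szd //.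
Qed.

Lemma small_path_is_arrangement (k r n : nat) (p : seq step) :
  0 < r <= k -> small_path k r n p ->
  exists X, [/\ size X.1 = (n * k).+1, size X.2 = n & p = arrangement_path k r X].
Proof.
move=> hr; rewrite -[p]rowsK; move: (rows p) => [w t] /=.
case/andP => /and3P[/eqP + wa dl nd].
rewrite /vertex take_size foldl_move_path_of => -[_]; rewrite add0n mulnC => szw.
have W : walk k r (0, 0) (path_of w t) by rewrite walkE wa dl.
have [i hi wi|ds szds wE] := @rows_of_exists k r n w hr szw.
  by rewrite -(walk_diag_level W hi wi).
by exists (t :: unzip1 w, ds); rewrite /arrangement_path /= -wE size_map szw.
Qed.

Lemma arrangements_uniq (N n : nat) (lam : seq nat) : uniq (arrangements N lam n).
Proof.
by apply: allpairs_uniq; rewrite ?permutations_uniq // => -[a b] [c d].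
Qed.

Lemma card_small_paths_of_type (k r n : nat) (lam : seq nat) :
  0 < r <= k -> 0 < n -> is_partition lam ->
  size lam <= (n * k).+1 -> sumn lam <= n ->
  #|small_paths_of_type k r n lam|
  = \sum_(X <- arrangements (n * k).+1 lam n) small_arrangement k X.
Proof.
move=> hr n0 hlam szl sl.
set L := arrangements _ _ _; rewrite cardE -(size_map val).
transitivity (size [seq arrangement_path k r X | X <- L & small_arrangement k X]); last first.
  by rewrite size_map size_filter -sum1_count big_mkcond; apply: eq_bigr => X _; case: ifP.
apply/perm_size/uniq_perm.
- by rewrite map_inj_uniq ?enum_uniq //; apply: val_inj.
- rewrite map_inj_in_uniq ?filter_uniq ?arrangements_uniq // => X Y.
  rewrite !mem_filter => /andP[_ /(arrangementsP _ szl sl)[s1 s2 _ _]].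
  case/andP=> _ /(arrangementsP _ szl sl)[s1' s2' _ _] /(congr1 rows).
  rewrite !path_ofK => -[E].
  case: X Y s1 s2 s1' s2' E => [[|t es] ds] [[|t' es'] ds'] //= [s1] s2 [s1'] s2' E ->.
  by have [||-> ->] := rows_of_inj hr _ _ E; rewrite ?s2 ?s2'.
move=> p; apply/mapP/mapP => [[q + ->]|[X + ->]].
  rewrite mem_enum inE => /andP[sp typ].
  have [X [s1 s2 E]] := small_path_is_arrangement hr sp; exists X => //.
  have := small_path_arrangement hr n0 hlam szl s1 s2.
  rewrite -E sp typ => /esym/and3P[/eqP tot pX sX].
  by rewrite mem_filter sX /=; apply/(arrangementsP _ szl sl).
rewrite mem_filter => /andP[sX /(arrangementsP _ szl sl)[s1 s2 tot pX]].
have := small_path_arrangement hr n0 hlam szl s1 s2.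
rewrite sX pX tot eqxx => /andP[sp typ].
have [lp _] := andP sp; exists (Bseq (size_large_path lp)) => //.
by rewrite mem_enum inE /= sp.
Qed.

Definition rotate_blocks (k : nat) (X : seq nat * seq bool) : seq nat * seq bool :=
  (head 0 X.1 :: rot k (behead X.1), rot 1 X.2).

Lemma sum_small_arrangement (k n : nat) (lam : seq nat) :
  0 < n -> size lam <= (n * k).+1 -> sumn lam <= n ->
  n * \sum_(X <- arrangements (n * k).+1 lam n) small_arrangement k X
  = \sum_(X <- arrangements (n * k).+1 lam n) head 0 X.1.
Proof.
move=> n0 szl sl; set L := arrangements _ _ _.
have LP X : reflect _ (X \in L) := arrangementsP X szl sl.
have stable X : X \in L -> rotate_blocks k X \in L.
  case: X => [[|t es] ds] /LP [//= [s1] s2 tot p].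
  apply/LP; rewrite /= !size_rot s1 s2; split=> //.
    rewrite -{}tot; congr (_ + _ + _); last by apply/permP; rewrite perm_rot.
    by apply: perm_sumn; rewrite perm_rot.
  by apply: perm_trans p; rewrite perm_cons perm_rot.
have inj : {in L &, injective (rotate_blocks k)}.
  move=> X Y /LP[sX _ _ _] /LP[sY _ _ _].
  case: X Y sX sY => [[|t es] ds] [[|t' es'] ds'] //= _ _.
  by case=> -> /rot_inj -> /rot_inj ->.
have invariant i : \sum_(X <- L) small_arrangement k X
    = \sum_(X <- L) small_arrangement k (iter i (rotate_blocks k) X).
  elim: i => // i ->; rewrite -[LHS](sum_reindex_uniq _ (arrangements_uniq _ _ _) inj stable).
  by apply: eq_bigr => X _; rewrite iterSr.
rewrite -[n in n * _]card_ord -sum_nat_const.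
rewrite (eq_bigr (fun i : 'I_n => \sum_(X <- L) small_arrangement k (iter i (rotate_blocks k) X)));
  last by move=> i _; apply: invariant.
rewrite exchange_big /= big_seq [RHS]big_seq; apply: eq_bigr => X XL.
have sz Y : Y \in L -> size (behead Y.1) = size Y.2 * k.
  by case/LP => s1 -> _ _; rewrite size_behead s1.
have [s1 s2 tot _] := LP _ XL.
pose b := block_sums k (behead X.1) X.2.
have szb : size b = n by rewrite size_block_sums.
have totb : head 0 X.1 + sumn b = n.
  by rewrite sumn_block_sums ?sz // -tot; case: (X.1) s1 => //= t es _; lia.
rewrite (_ : head 0 X.1 = size b - sumn b); last by lia.
rewrite -cycle_lemma ?szb; last by lia.
apply: eq_bigr => -[i /= lt_in] _; congr (nat_of_bool (subdiagonal _)).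
pose Y j := iter j (rotate_blocks k) X.
suff [_ _ ->] : [/\ Y i \in L, size (Y i).2 = n
                 & block_sums k (behead (Y i).1) (Y i).2 = rot i b] by [].
elim: i lt_in => [|i IHi] lt_in; first by rewrite /= rot0.
have [XiL si Ei] := IHi (ltnW lt_in).
rewrite /Y iterS; split; first exact: stable.
  by rewrite size_rot.
by rewrite /Y [LHS]/= block_sums_rot ?si ?(sz _ XiL) ?si // Ei -rotS // szb ltnW.
Qed.

Lemma count_small_paths (k r n : nat) (lam : seq nat) :
  0 < r <= k -> 0 < n -> is_partition lam -> sumn lam <= n ->
  #|small_paths_of_type k r n lam|
    * (n * (n * k).+1 * (mult_fact lam * ((n * k).+1 - size lam)`!)
       * ((sumn lam)`! * (n - sumn lam)`!))
  = sumn lam * (n * k).+1`! * n`!.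
Proof.
move=> hr n0 hlam sl.
have lam_pos : all (ltn 0) lam by case/andP: hlam.
have szl : size lam <= (n * k).+1.
  by have := leq_size_sumn lam_pos; case/andP: hr; nia.
set N := (n * k).+1 in szl *.
set es0 := lam ++ nseq (N - size lam) 0.
set ds0 := nseq (sumn lam) false ++ nseq (n - sumn lam) true.
have sz_es0 : size es0 = N by rewrite size_cat size_nseq subnKC.
have sz_ds0 : size ds0 = n by rewrite size_cat !size_nseq subnKC.
have pes : size (permutations es0) * (mult_fact lam * (N - size lam)`!) = N`!.
  rewrite -[in RHS]sz_es0 -(@size_permutations_prod _ es0 (iota 0 (sumn lam).+1)) ?iota_uniq //.
    congr (_ * _); rewrite /= big_cons mulnC; congr (_ * _).
      have lam0 : 0 \notin lam by apply/negP => /(allP lam_pos).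
      by rewrite count_cat count_nseq /= mul1n (count_memPn lam0).
    rewrite /mult_fact /index_iota subn1 /=; apply: eq_big_seq => i.
    rewrite mem_iota => /andP[i0 _]; rewrite count_cat count_nseq /=.
    by case: i i0 => //= i _; rewrite addn0.
  move=> x; rewrite mem_cat mem_nseq mem_iota /= add0n => /orP[|/andP[_ /eqP-> //]].
  by move/perm_to_rem/perm_sumn => -> /=; rewrite ltnS leq_addr.
have pds : size (permutations ds0) * ((sumn lam)`! * (n - sumn lam)`!) = n`!.
  rewrite -[in RHS]sz_ds0 -(@size_permutations_prod _ ds0 [:: false; true]) //; last by case.
  by rewrite !big_cons big_nil !count_cat !count_nseq /= !mul1n !mul0n addn0 add0n muln1.
have E := sum_small_arrangement n0 szl sl.
rewrite -(card_small_paths_of_type hr n0 hlam szl sl) in E.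
have H : N * \sum_(X <- arrangements N lam n) head 0 X.1
    = sumn lam * size (permutations es0) * size (permutations ds0).
  rewrite big_allpairs_dep /=.
  rewrite (eq_bigr (fun es => head 0 es * size (permutations ds0))); last first.
    by move=> es _; rewrite big_const_seq count_predT iter_addn addn0.
  rewrite -big_distrl mulnA -{1}sz_es0 /= sum_head_permutations.
  by rewrite sumn_cat sumn_nseq mul0n addn0.
rewrite -pes -pds; set m := mult_fact _ * _; set f := _`! * _.
set c := #|_| in E *.
transitivity (N * (n * c) * m * f); first by ring.
by rewrite E H; ring.
Qed.

Lemma mult_fact_gt0 (lam : seq nat) : 0 < mult_fact lam.
Proof.
rewrite /mult_fact; elim/big_ind: _ => // [x y|i _]; last exact: fact_gt0.
by rewrite muln_gt0 => -> ->.
Qed.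

Lemma sumn_path_type (k r n : nat) (p : seq step) :
  large_path k r n p -> sumn (path_type p) <= n.
Proof.
case/and3P => /eqP + _ _; rewrite /vertex take_size /path_type.
rewrite (perm_sumn (_ : perm_eq _ (east_runs p))); last by rewrite perm_sort.
rewrite -[p]rowsK; move: (rows p) => [w t] /=.
rewrite foldl_move_path_of east_runs_path_of => -[<- _] /=.
have -> (s : seq nat) : sumn [seq e <- s | 0 < e] = sumn s.
  by elim: s => //= -[|x] s IHs //=; rewrite IHs.
by rewrite sumn_rcons; lia.
Qed.

Lemma count_small_paths_formula (k r n : nat) (lam : seq nat) :
  0 < r <= k -> 0 < n -> is_partition lam ->
  #|small_paths_of_type k r n lam| * ((n * k).+1 * mult_fact lam)
  = binz (n - 1) ((sumn lam)%:Z - 1)%R * ((n * k).+1 ^_ (size lam)).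
Proof.
move=> hr n0 hlam.
case: (leqP (sumn lam) n) => sl; last first.
  rewrite (_ : small_paths_of_type k r n lam = set0); last first.
    apply/setP => p; rewrite !inE; apply/negP => /andP[/andP[lp _] /eqP typ].
    by have := sumn_path_type lp; rewrite typ leqNgt sl.
  rewrite cards0 mul0n (_ : ((sumn lam)%:Z - 1)%R = (sumn lam - 1)%N); last by lia.
  by rewrite /= bin_small //; lia.
have szl : size lam <= (n * k).+1.
  have lam_pos : all (ltn 0) lam by case/andP: hlam.
  by have := leq_size_sumn lam_pos; case/andP: hr; nia.
have E := count_small_paths hr n0 hlam sl.
case s_eq: (sumn lam) => [|s]; last first.
  rewrite s_eq in sl E; rewrite (_ : (s.+1%:Z - 1)%R = s) /=; last by lia.
  have B : 'C(n - 1, s) * (s`! * (n - 1 - s)`!) = (n - 1)`! by apply: bin_fact; lia.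
  have F := ffact_fact szl.
  have n_fact : n`! = n * (n - 1)`! by case: (n) n0 => // m _; rewrite factS subn1.
  move: E; rewrite n_fact -{}B -{}F factS.
  rewrite (_ : n - s.+1 = n - 1 - s); last by lia.
  set c := #|_|; set N := (n * k).+1; set f := _`!; set g := _`!; set h := _`!.
  move=> E; have pos : 0 < n * f * (s.+1 * g * h) by rewrite !muln_gt0 n0 !fact_gt0.
  by apply/eqP; rewrite -(eqn_pmul2r pos); apply/eqP; lia.
move: E; rewrite s_eq !mul0n => /eqP; rewrite !muln_eq0 !(gtn_eqF (fact_gt0 _)).
by rewrite (gtn_eqF n0) (gtn_eqF (mult_fact_gt0 lam)) /= orbF => /eqP ->.
Qed.

Local Open Scope ring_scope.

Theorem theorem3p3 (k n r : nat) (lam : seq nat)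
    (hk : (1 <= k)%N) (hn : (1 <= n)%N) (hr : (1 <= r <= k)%N)
    (hlam : is_partition lam) :
  let l := size lam in
  let m : rat := (mult_fact lam)%:R in
  let count : rat := #|small_paths_of_type k r n lam|%:R in
  [/\ count = (binz (n - 1) ((sumn lam)%:Z - 1))%:R
                * (binz (n * k) (l%:Z - 1))%:R * ((l - 1)`!%:R / m)
        /\ count = ((n * k).+1%:R)^-1
                * (binz (n - 1) ((sumn lam)%:Z - 1))%:R
                * 'C((n * k).+1, l)%:R * (l`!%:R / m),
      k = 1%N ->
        count = (binz (n - 1) ((sumn lam)%:Z - 1))%:R
                * (binz n (l%:Z - 1))%:R * ((l - 1)`!%:R / m)
        /\ count = (n.+1%:R)^-1
                * (binz (n - 1) ((sumn lam)%:Z - 1))%:R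
                * 'C(n.+1, l)%:R * (l`!%:R / m)
    & sumn lam = n ->
        count = (binz (n * k) (l%:Z - 1))%:R * ((l - 1)`!%:R / m)
        /\ count = ((n * k).+1%:R)^-1
                * 'C((n * k).+1, l)%:R * (l`!%:R / m)].
Proof.
move=> l m count.
have m_neq0 : m != 0 by rewrite pnatr_eq0 -lt0n mult_fact_gt0.
have N_neq0 : (n * k).+1%:R != 0 :> rat by rewrite pnatr_eq0.
have second : count = ((n * k).+1%:R)^-1 * (binz (n - 1) ((sumn lam)%:Z - 1))%:R
    * 'C((n * k).+1, l)%:R * (l`!%:R / m).
  have /(congr1 (fun x : nat => x%:R : rat)) := count_small_paths_formula hr hn hlam.
  rewrite -bin_ffact !natrM -/m -/count => E.
  apply: (mulIf (mulf_neq0 N_neq0 m_neq0)); rewrite {}E.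
  move: m ((n * k).+1%:R : rat) m_neq0 N_neq0 => M N M0 N0.
  by field; rewrite M0 N0.
have first : count = (binz (n - 1) ((sumn lam)%:Z - 1))%:R
    * (binz (n * k) (l%:Z - 1))%:R * ((l - 1)`!%:R / m).
  rewrite {}second /l; case: (lam) => [|a s]; first by rewrite /= mulr0 !mul0r.
  have -> : (size (a :: s))%:Z - 1 = size s by rewrite /= ; lia.
  move: (binz _ _) => B; rewrite [size (a :: s)]/= subn1 [binz _ _]/=.
  have /(congr1 (fun x : nat => x%:R : rat)) := mul_bin_diag (n * k).+1 (size s).
  rewrite /= factS !natrM => E.
  rewrite [RHS](_ : _ = (n * k).+1%:R^-1 * B%:R
    * ((n * k).+1%:R * 'C(n * k, size s)%:R) * ((size s)`!%:R / m)); last first.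
    move: m ((n * k).+1%:R : rat) m_neq0 N_neq0 => M N M0 N0.
    by field; rewrite M0 N0.
  rewrite {}E; move: m ((n * k).+1%:R : rat) m_neq0 N_neq0 => M N M0 N0.
  by field; rewrite M0 N0.
split=> // [k1|sn]; first by rewrite k1 muln1 in first second.
have one : binz (n - 1) ((sumn lam)%:Z - 1) = 1%N.
  by rewrite sn (_ : (n%:Z - 1)%R = (n - 1)%N) /= ?binn //; lia.
by rewrite one ?mulr1 ?mul1r in first second.
Qed.
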